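(* Consider the closed-loop system $x_{t+1}=f(x_t)+g(x_t)(u_t^a+u_t^m+h(x_t))$ started at $x_0$, with $u_t^a$, $u_t^m$, the value function $V_m$, the level sets $\mathcal X_c(\cdot)$, the union $\mathcal X_c$ and the constants $c,c_1,c_2,c_3$ as described in the context. Define $\bar c=\frac{c_2c_3}{c_1}(\delta_gu^a_{\max}+w_{\max})$. If $\delta_gu^a_{\max}+w_{\max}<\frac{c_1}{c_2c_3}c$, then for all $t\ge N$ the following hold: (i) for every $x_t\in\mathcal X_c(0)\setminus\mathcal X_{\bar c}(0)$, $V_m(x_{t+1})<V_m(x_t)$; (ii) for every $x_t\in\mathcal X_{\bar c}(0)$, $x_{t+1}\in\mathcal X_{\bar c}(0)$ (that is, $V_m(x_t)\le\bar c$ implies $V_m(x_{t+1})\le\bar c$); (iii) in addition, if $\mathcal X_c\subset\mathcal X$, then $x_t\in\mathcal X$ for all $t$.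
   Context: Norms: $\|\cdot\|$ is the Euclidean norm (induced 2-norm for matrices), $\|v\|_M^2=v^\top Mv$; $M^{(i)}$ is the $i$-th column of $M$; $M^\dagger$ is the pseudo-inverse. **System.** $x_{t+1}=f(x_t)+g(x_t)(u_t+h(x_t))$, $t=0,1,2,\dots$, $u_t=u_t^a+u_t^m\in\mathbb U=\{v\in\mathbb R^m:\|v\|_\infty\le u_{\max}\}$; $\mathcal X\subset\mathbb R^d$ is the compact state constraint set. $f:\mathbb R^d\to\mathbb R^d$ and $g:\mathbb R^d\to\mathbb R^{d\times m}$ are Lipschitz, $h$ is continuous with values in $\mathbb R^m$, and $\|g(x)h(x)\|\le w_{\max}$, $\|g(x)\|\le\delta_g$, $\operatorname{rank} g(x)=m$ for every $x\in\mathbb R^d$. Put $\bar f(x,u)=f(x)+g(x)u$. **Learning component.** There are times $0=t_0<t_1<\cdots$ and feature maps $\phi_j:\mathbb R^d\to\mathbb R^{n_L+1}$ ($j\ge0$) whose first $m$ entries equal $1$ and which satisfy $\|\phi_j(x)\|\le\sigma$ for every $x\in\mathcal X$ and $j\ge0$. For $t\in\{t_j,\dots,t_{j+1}-1\}$: $u_t^a=-K_t^\top\phi_j(x_t)$ and, with $\theta\in(0,1)$, $\bar K_{t+1}=K_t+\frac{\theta}{\|\phi_j(x_t)\|^2}\phi_j(x_t)\big(g(x_t)^\dagger(x_{t+1}-\bar f(x_t,u_t^m))\big)^\top$; columnwise, $K_{t+1}^{(i)}=\bar K_{t+1}^{(i)}$ if $\|\bar K_{t+1}^{(i)}\|\le\bar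 W_i$, and $K_{t+1}^{(i)}=\frac{\bar W_i}{\|\bar K_{t+1}^{(i)}\|}\bar K_{t+1}^{(i)}$ otherwise; initially $\|K_0^{(i)}\|\le\bar W_i$ ($i=1,\dots,m$, $\bar W_i>0$ given). Let $\tilde u_t=u_t^a+h(x_t)$, $\bar W=\sum_{i=1}^m\bar W_i^2$, $u^a_{\max}=\sqrt{\bar W}\,\sigma$ (with $u^a_{\max}<u_{\max}$), $w'_{\max}=\delta_gu^a_{\max}+w_{\max}$, $\mathbb W'=\{v\in\mathbb R^d:\|v\|\le w'_{\max}\}$. **Reference.** Let $\mathbb U'=\{v\in\mathbb R^m:\|v\|_\infty\le u_{\max}-u^a_{\max}\}$ and let $N\ge1$ be an integer. $(x_i^r,u_i^r)_{i=0}^{N-1}$ is a minimizer of $\sum_{i=0}^{N-1}\big(\|x_i^r\|_{Q'}^2+\|u_i^r\|_{R'}^2\big)$ ($Q',R'\succ0$) subject to $x_0^r=x_0$, $x_N^r=0$, $x_{i+1}^r=\bar f(x_i^r,u_i^r)$, $x_i^r\in\mathcal X_r\subset\mathcal X$, $u_i^r\in\mathbb U_r\subset\mathbb U'$, for given (tightened) sets $\mathcal X_r,\mathbb U_r$. Put $x_t^r=0$, $u_t^r=0$ for $t\ge N$. **MPC component.** With $Q,R,Q_f\succ0$ let $c_{\mathrm f}(x)=x^\top Q_fx$. For $x\in\mathbb R^d$ let $V_{m,t}(x)$ be the minimum over $(u_{t+i|t})_{i=0}^{N-1}$ of the cost $$c_{\mathrm f}(x_{t+N|t})+\sum_{i=0}^{N-1}\Big(\|x_{t+i|t}-x_{t+i}^r\|_Q^2+\|u_{t+i|t}-u_{t+i}^r\|_R^2\Big)$$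 subject to $x_{t|t}=x$, $x_{t+i+1|t}=\bar f(x_{t+i|t},u_{t+i|t})$ for $0\le i\le N-1$, $u_{t|t}+u_t^a\in\mathbb U$, and $u_{t+i|t}\in\mathbb U'$ for $1\le i\le N-1$, where $u_t^a$ is held fixed at its actual closed-loop value. Write $V_m(x_t)=V_{m,t}(x_t)$. The MPC component is $u_t^m=u^*_{t|t}$, the first element of a minimizer for $x=x_t$. Level sets, for $c>0$: $\mathcal X_c(x_t^r)=\{x\in\mathbb R^d:V_{m,t}(x)\le c\}$, written $\mathcal X_c(0)$ when $t\ge N$ (zero reference), and $\mathcal X_c=\bigcup_{t=0}^{N}\mathcal X_c(x_t^r)$. **Terminal assumption.** With $\mathcal X_f=\{x:c_{\mathrm f}(x)\le\alpha\}$, $\alpha>0$: for every $x\in\mathcal X_f$ there is $u'\in\mathbb U'$ with $c_{\mathrm f}(\bar f(x,u'))-c_{\mathrm f}(x)\le-(\|x\|_Q^2+\|u'\|_R^2)$. **Constants.** $c>0$ is the fixed level used above. $c_2>c_1>0$ are constants with $c_1\|x_t-x_t^r\|^2\le\|x_t-x_t^r\|_Q^2+\|u^*_{t|t}-u_t^r\|_R^2\le V_m(x_t)\le c_2\|x_t-x_t^r\|^2$ for all $t$. $c_3>0$ is a Lipschitz constant, on the set $\mathcal X_c+\mathbb W'$, of the MPC cost as a function of its initial state with the control sequence held fixed; with this $c_3$ one has $V_m(x_{t+1})\le\big(1-\tfrac{c_1}{c_2}\big)V_m(x_t)+c_3\|g(x_t)\tilde u_t\|$ for all $t$ and every $x_t\in\mathcal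 X_c(x_t^r)$.
   Formalization: In (i) and (ii), x_t is additionally assumed to lie in the state constraint set (the feature bound holds only there), and the union X_c is taken over the level sets at all times t, not only t=0,…,N, since the sets X_c(0) may vary with t; without these the claims can fail. *)

(* Defs.v *)
(* MathComp / MathComp-Analysis. *)
From HB Require Import structures.
From mathcomp Require Import all_boot all_order all_algebra.
From mathcomp Require Import all_classical all_reals all_analysis.

Set Implicit Arguments.
Unset Strict Implicit.
Unset Printing Implicit Defensive.

Import Order.TTheory GRing.Theory Num.Theory.
Import numFieldNormedType.Exports.

Local Open Scope classical_set_scope.
Local Open Scope ring_scope.

(* The library norm `|v| on 'cV[R]_n is the max norm; it is used below for
   ||.||_oo, while enorm is the Euclidean norm. *)
Definition enorm (R : realType) (n : nat) (v : 'cV[R]_n) : R :=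
  Num.sqrt (\sum_(i < n) v i 0 ^+ 2).

Definition opnorm (R : realType) (p q : nat) (A : 'M[R]_(p, q)) : R :=
  sup [set enorm (A *m v) | v in [set v : 'cV[R]_q | enorm v <= 1]].

Definition qform (R : realType) (n : nat) (M : 'M[R]_n) (v : 'cV[R]_n) : R :=
  (v^T *m M *m v) 0 0.

Definition posdef (R : realType) (n : nat) (M : 'M[R]_n) : Prop :=
  M^T = M /\ forall v : 'cV[R]_n, v != 0 -> 0 < qform M v.

Definition penrose (R : realType) (p q : nat)
    (A : 'M[R]_(p, q)) (B : 'M[R]_(q, p)) : Prop :=
  [/\ A *m B *m A = A, B *m A *m B = B,
      (A *m B)^T = A *m B & (B *m A)^T = B *m A].

(* Moore-Penrose inverse: every real matrix has exactly one B satisfying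
   [penrose], so the default value 0 of xget is never used.  (The library's
   pinvmx is only a generalized inverse.) *)
Definition mp_inverse (R : realType) (p q : nat) (A : 'M[R]_(p, q)) : 'M[R]_(q, p) :=
  xget 0 [set B | penrose A B].

Definition project_cols (R : realType) (p q : nat) (W : 'I_q -> R)
    (M : 'M[R]_(p, q)) : 'M[R]_(p, q) :=
  \matrix_(i, j) (if enorm (col j M) <= W j then M i j
                  else W j / enorm (col j M) * M i j).

Definition infball (R : realType) (n : nat) (r : R) : set 'cV[R]_n :=
  [set v | `|v| <= r].
Arguments infball {R} n r.

Definition eball (R : realType) (n : nat) (r : R) : set 'cV[R]_n :=
  [set v | enorm v <= r].
Arguments eball {R} n r.

Definition setsum (R : realType) (n : nat) (A B : set 'cV[R]_n) : set 'cV[R]_n :=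
  [set a + b | a in A & b in B].

Definition fbar (R : realType) (d m : nat)
    (f : 'cV[R]_d -> 'cV[R]_d) (g : 'cV[R]_d -> 'M[R]_(d, m))
    (x : 'cV[R]_d) (u : 'cV[R]_m) : 'cV[R]_d :=
  f x + g x *m u.

(* Finite-horizon sequences are functions on nat of which only the first N
   (for states: N + 1) values matter. *)
Definition ref_feasible (R : realType) (d m N : nat)
    (f : 'cV[R]_d -> 'cV[R]_d) (g : 'cV[R]_d -> 'M[R]_(d, m))
    (Xr : set 'cV[R]_d) (Ur : set 'cV[R]_m) (x0 : 'cV[R]_d)
    (y : nat -> 'cV[R]_d) (v : nat -> 'cV[R]_m) : Prop :=
  [/\ y 0%N = x0, y N = 0 &
      forall i, (i < N)%N -> [/\ y i.+1 = fbar f g (y i) (v i), Xr (y i) & Ur (v i)]].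

Definition ref_cost (R : realType) (d m N : nat) (Q' : 'M[R]_d) (R' : 'M[R]_m)
    (y : nat -> 'cV[R]_d) (v : nat -> 'cV[R]_m) : R :=
  \sum_(i < N) (qform Q' (y i) + qform R' (v i)).

(* The reference extended by zero after the horizon. *)
Definition is_reference (R : realType) (d m N : nat)
    (f : 'cV[R]_d -> 'cV[R]_d) (g : 'cV[R]_d -> 'M[R]_(d, m))
    (Q' : 'M[R]_d) (R' : 'M[R]_m)
    (Xr : set 'cV[R]_d) (Ur : set 'cV[R]_m) (x0 : 'cV[R]_d)
    (xr : nat -> 'cV[R]_d) (ur : nat -> 'cV[R]_m) : Prop :=
  [/\ ref_feasible N f g Xr Ur x0 xr ur,
      forall y v, ref_feasible N f g Xr Ur x0 y v ->
        ref_cost N Q' R' xr ur <= ref_cost N Q' R' y v &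
      forall t, (N <= t)%N -> xr t = 0 /\ ur t = 0].

Fixpoint predict (R : realType) (d m : nat)
    (f : 'cV[R]_d -> 'cV[R]_d) (g : 'cV[R]_d -> 'M[R]_(d, m))
    (x : 'cV[R]_d) (u : nat -> 'cV[R]_m) (i : nat) : 'cV[R]_d :=
  if i is k.+1 then fbar f g (predict f g x u k) (u k) else x.

Definition mpc_cost (R : realType) (d m N : nat)
    (f : 'cV[R]_d -> 'cV[R]_d) (g : 'cV[R]_d -> 'M[R]_(d, m))
    (Q Qf : 'M[R]_d) (Ru : 'M[R]_m)
    (xr : nat -> 'cV[R]_d) (ur : nat -> 'cV[R]_m)
    (t : nat) (x : 'cV[R]_d) (u : nat -> 'cV[R]_m) : R :=
  qform Qf (predict f g x u N) +
  \sum_(i < N) (qform Q (predict f g x u i - xr (t + i)%N) +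
                qform Ru (u i - ur (t + i)%N)).

(* ua is the learning component applied at the current time. *)
Definition mpc_admissible (R : realType) (m N : nat) (umax uamax : R)
    (ua : 'cV[R]_m) (u : nat -> 'cV[R]_m) : Prop :=
  infball m umax (u 0%N + ua) /\
  forall i, (0 < i < N)%N -> infball m (umax - uamax) (u i).

(* For continuous f and g the cost is continuous on a compact set of control
   sequences, so the infimum is a minimum whenever some sequence is admissible;
   otherwise it is +oo, and x belongs to no level set. *)
Definition mpc_value (R : realType) (d m N : nat)
    (f : 'cV[R]_d -> 'cV[R]_d) (g : 'cV[R]_d -> 'M[R]_(d, m))
    (Q Qf : 'M[R]_d) (Ru : 'M[R]_m)
    (xr : nat -> 'cV[R]_d) (ur : nat -> 'cV[R]_m) (umax uamax : R)
    (ua : nat -> 'cV[R]_m) (t : nat) (x : 'cV[R]_d) : \bar R :=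
  ereal_inf [set (mpc_cost N f g Q Qf Ru xr ur t x u)%:E |
             u in mpc_admissible N umax uamax (ua t)].

Definition mpc_minimizer (R : realType) (d m N : nat)
    (f : 'cV[R]_d -> 'cV[R]_d) (g : 'cV[R]_d -> 'M[R]_(d, m))
    (Q Qf : 'M[R]_d) (Ru : 'M[R]_m)
    (xr : nat -> 'cV[R]_d) (ur : nat -> 'cV[R]_m) (umax uamax : R)
    (ua : nat -> 'cV[R]_m) (t : nat) (x : 'cV[R]_d)
    (u : nat -> 'cV[R]_m) : Prop :=
  mpc_admissible N umax uamax (ua t) u /\
  forall v, mpc_admissible N umax uamax (ua t) v ->
    mpc_cost N f g Q Qf Ru xr ur t x u <= mpc_cost N f g Q Qf Ru xr ur t x v.

Definition level (R : realType) (d : nat) (V : nat -> 'cV[R]_d -> \bar R)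
    (c : R) (t : nat) : set 'cV[R]_d :=
  [set x | (V t x <= c%:E)%E].

(* For t >= N the reference is zero, but level V c t still depends on t through
   the learning component in the constraint on the first control.  Each of
   these sets is a zero-reference level set, so the union ranges over all t
   rather than stopping at the first such t, namely N. *)
Definition all_levels (R : realType) (d : nat) (V : nat -> 'cV[R]_d -> \bar R)
    (c : R) : set 'cV[R]_d :=
  \bigcup_t level V c t.

(* Main.v *)
(* Column-wise projection keeps every weight column in its ball, so on X the
   learning input is bounded by uamax (Cauchy-Schwarz) and the disturbance
   g (ua + h) by w' := deltag * uamax + wmax.  The value then obeys
   V+ <= (1 - c1 / c2) V + c3 w', whose fixed point is cbar: it strictly
   decreases above cbar and cannot leave [0, b] for any b >= cbar.  As
   V 0 (x 0) <= 0 and cbar < c, the level c is never left, whence (iii). *)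
Require Import Defs.
From HB Require Import structures.
From mathcomp Require Import all_boot all_order all_algebra.
From mathcomp Require Import all_classical all_reals all_analysis.
From mathcomp Require Import ring lra zify.

Set Implicit Arguments.
Unset Strict Implicit.
Unset Printing Implicit Defensive.

Import Order.TTheory GRing.Theory Num.Theory.
Import numFieldNormedType.Exports.

Local Open Scope classical_set_scope.
Local Open Scope ring_scope.

(** Lagrange's identity: the double sum of the squares [(a i * b j - a j * b i) ^+ 2] is twice the
    defect in the Cauchy-Schwarz inequality. *)
Lemma sum_mul_sqr_le (R : realDomainType) (n : nat) (a b : 'I_n -> R) :
  (\sum_i a i * b i) ^+ 2 <= (\sum_i a i ^+ 2) * (\sum_i b i ^+ 2).
Proof.
have : 0 <= \sum_i \sum_j (a i * b j - a j * b i) ^+ 2.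
  by apply: sumr_ge0 => i _; apply: sumr_ge0 => j _; exact: sqr_ge0.
have -> : \sum_i \sum_j (a i * b j - a j * b i) ^+ 2 =
    2 * ((\sum_i a i ^+ 2) * (\sum_i b i ^+ 2)) - 2 * (\sum_i a i * b i) ^+ 2.
  have E1 : (\sum_i a i ^+ 2) * (\sum_i b i ^+ 2) =
      \sum_i \sum_j a i ^+ 2 * b j ^+ 2 by rewrite big_distrlr.
  have E2 : (\sum_i a i ^+ 2) * (\sum_i b i ^+ 2) =
      \sum_i \sum_j a j ^+ 2 * b i ^+ 2 by rewrite E1 exchange_big.
  have E3 : (\sum_i a i * b i) ^+ 2 =
      \sum_i \sum_j (a i * b i) * (a j * b j) by rewrite expr2 big_distrlr.
  rewrite mulr2n mulrDl mul1r {1}E1 E2 E3 -big_split mulr_sumr -sumrB /=.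
  apply: eq_bigr => i _; rewrite -big_split mulr_sumr -sumrB /=.
  by apply: eq_bigr => j _; ring.
by rewrite -mulrBr pmulr_rge0 // subr_ge0.
Qed.

Section EuclideanNorm.
Variable R : realType.
Implicit Types (n p q : nat).

Lemma enorm_ge0 n (v : 'cV[R]_n) : 0 <= enorm v.
Proof. exact: sqrtr_ge0. Qed.

Lemma sqr_enorm n (v : 'cV[R]_n) : enorm v ^+ 2 = \sum_i v i 0 ^+ 2.
Proof. by rewrite sqr_sqrtr // sumr_ge0 // => i _; exact: sqr_ge0. Qed.

Lemma enorm0 n : enorm (0 : 'cV[R]_n) = 0.
Proof.
by rewrite /enorm big1 ?sqrtr0 // => i _; rewrite mxE expr0n.
Qed.

Lemma enormZ n (a : R) (v : 'cV[R]_n) : enorm (a *: v) = `|a| * enorm v.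
Proof.
rewrite /enorm -sqrtr_sqr -sqrtrM ?sqr_ge0 // mulr_sumr.
by congr Num.sqrt; apply: eq_bigr => i _; rewrite mxE exprMn.
Qed.

Lemma enormN n (v : 'cV[R]_n) : enorm (- v) = enorm v.
Proof. by rewrite -scaleN1r enormZ normrN1 mul1r. Qed.

Lemma enorm_eq0 n (v : 'cV[R]_n) : (enorm v == 0) = (v == 0).
Proof.
apply/idP/eqP => [/eqP v0|->]; last by rewrite enorm0.
have := sqr_enorm v; rewrite v0 expr0n => /esym/eqP.
rewrite psumr_eq0 => [/allP v_eq0|i _]; last exact: sqr_ge0.
apply/colP => i; rewrite mxE; apply/eqP.
by have := v_eq0 i (mem_index_enum i); rewrite /= sqrf_eq0.
Qed.

Lemma ler_enormD n (u v : 'cV[R]_n) : enorm (u + v) <= enorm u + enorm v.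
Proof.
rewrite -ler_sqr ?nnegrE ?addr_ge0 ?enorm_ge0 // sqrrD !sqr_enorm.
have -> : \sum_i (u + v) i 0 ^+ 2 = \sum_i u i 0 ^+ 2 +
    (\sum_i u i 0 * v i 0) *+ 2 + \sum_i v i 0 ^+ 2.
  rewrite -sumrMnl -!big_split /=.
  by apply: eq_bigr => i _; rewrite mxE sqrrD.
rewrite lerD2r lerD2l lerMn2r /=.
apply: (le_trans (ler_norm _)).
rewrite -ler_sqr ?nnegrE ?mulr_ge0 ?enorm_ge0 ?normr_ge0 //.
by rewrite exprMn !sqr_enorm real_normK ?num_real // sum_mul_sqr_le.
Qed.

(** Each entry of [A^T *m v] is the inner product of a column of [A] with [v], so Cauchy-Schwarz
    applies entrywise; the constant is the Frobenius norm of [A]. *)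
Lemma enorm_trmx_mul p q (A : 'M[R]_(p, q)) (v : 'cV[R]_p) :
  enorm (A^T *m v) <= Num.sqrt (\sum_i enorm (col i A) ^+ 2) * enorm v.
Proof.
rewrite -ler_sqr ?nnegrE ?mulr_ge0 ?enorm_ge0 ?sqrtr_ge0 // exprMn.
rewrite sqr_enorm sqr_sqrtr; last by apply: sumr_ge0 => i _; exact: sqr_ge0.
rewrite mulr_suml; apply: ler_sum => i _; rewrite mxE !sqr_enorm.
apply: le_trans (sum_mul_sqr_le _ _) _.
by under [X in X * _ <= _]eq_bigr do rewrite mxE;
  under [X in _ <= X * _]eq_bigr do rewrite mxE.
Qed.

(** Makes the [sup] in [opnorm] a genuine least upper bound; the Frobenius norm of [A] bounds the
    set. *)
Lemma opnorm_has_sup p q (A : 'M[R]_(p, q)) :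
  has_sup [set enorm (A *m v) | v in [set v : 'cV[R]_q | enorm v <= 1]].
Proof.
split; first by exists (enorm (A *m 0)); exists 0; rewrite //= enorm0.
exists (Num.sqrt (\sum_i enorm (col i A^T) ^+ 2)) => _ [v /= v1 <-].
rewrite -[A in enorm (A *m _)]trmxK.
by apply: le_trans (enorm_trmx_mul _ _) _; rewrite ler_piMr ?sqrtr_ge0.
Qed.

Lemma opnorm_ge0 p q (A : 'M[R]_(p, q)) : 0 <= opnorm A.
Proof.
apply: le_trans (enorm_ge0 (A *m 0)) _.
apply: ub_le_sup; first exact: (opnorm_has_sup A).2.
by exists 0; rewrite //= enorm0.
Qed.

Lemma enorm_mulmx p q (A : 'M[R]_(p, q)) (v : 'cV[R]_q) :
  enorm (A *m v) <= opnorm A * enorm v.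
Proof.
have [->|v_neq0] := eqVneq v 0; first by rewrite mulmx0 !enorm0 mulr0.
have v_gt0 : 0 < enorm v by rewrite lt_def enorm_eq0 v_neq0 enorm_ge0.
rewrite -ler_pdivrMr //; apply: ub_le_sup.
  exact: (opnorm_has_sup A).2.
exists ((enorm v)^-1 *: v) => /=.
  by rewrite enormZ ger0_norm ?invr_ge0 ?enorm_ge0 // mulVf ?gt_eqF.
by rewrite -scalemxAr enormZ ger0_norm ?invr_ge0 ?enorm_ge0 // mulrC.
Qed.

Lemma enorm_col_project p q (W : 'I_q -> R) (M : 'M[R]_(p, q)) (i : 'I_q) :
  0 <= W i -> enorm (col i (project_cols W M)) <= W i.
Proof.
move=> W_ge0; have [le_W|lt_W] := leP (enorm (col i M)) (W i).
  have -> // : col i (project_cols W M) = col i M.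
  by apply/colP => k; rewrite !mxE le_W.
have M_gt0 : 0 < enorm (col i M) by apply: le_lt_trans lt_W.
have -> : col i (project_cols W M) = (W i / enorm (col i M)) *: col i M.
  by apply/colP => k; rewrite !mxE leNgt lt_W.
by rewrite enormZ ger0_norm ?divr_ge0 ?enorm_ge0 // divfK ?gt_eqF.
Qed.

End EuclideanNorm.

Lemma increasing_bracket (s : nat -> nat) (t : nat) :
  s 0%N = 0%N -> (forall j, (s j < s j.+1)%N) ->
  exists j, (s j <= t < s j.+1)%N.
Proof.
move=> s0 s_incr.
have [j t_lt] : exists j, (t < s j)%N.
  (* [t < s t.+1] unfolds to [t.+1 <= s t.+1], an instance of [n <= s n], which is proved by
     induction. *)
  exists t.+1; elim: {1 2}t.+1 => // n IHn.
  by have := s_incr n; lia.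
(* The least index with [t < s j] is not 0 because [s 0 = 0]; by minimality its predecessor starts
   the bracket. *)
case: (ex_minnP (ex_intro (fun j => t < s j)%N j t_lt)) => -[|k] lt_k min_k.
  by rewrite s0 in lt_k.
by exists k; rewrite lt_k andbT leqNgt; apply/negP => /min_k; rewrite ltnn.
Qed.

Theorem proposition1 (R : realType) (d m nL N : nat)
  (* system *)
  (f : 'cV[R]_d -> 'cV[R]_d) (g : 'cV[R]_d -> 'M[R]_(d, m))
  (h : 'cV[R]_d -> 'cV[R]_m) (X : set 'cV[R]_d) (umax wmax deltag : R)
  (X_compact : compact X)
  (f_lip : exists L : R, forall x y, enorm (f x - f y) <= L * enorm (x - y))
  (g_lip : exists L : R, forall x y, opnorm (g x - g y) <= L * enorm (x - y))
  (h_cont : continuous h)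
  (gh_bound : forall x, enorm (g x *m h x) <= wmax)
  (g_bound : forall x, opnorm (g x) <= deltag)
  (g_rank : forall x, \rank (g x) = m)
  (* closed-loop trajectory, its two input components and the weights *)
  (x : nat -> 'cV[R]_d) (ua um : nat -> 'cV[R]_m) (K : nat -> 'M[R]_(nL.+1, m))
  (closed_loop : forall t, x t.+1 = f (x t) + g (x t) *m (ua t + um t + h (x t)))
  (* learning component *)
  (tj : nat -> nat) (phi : nat -> 'cV[R]_d -> 'cV[R]_nL.+1)
  (sigma theta : R) (W : 'I_m -> R)
  (uamax : R := Num.sqrt (\sum_(i < m) W i ^+ 2) * sigma)
  (tj0 : tj 0%N = 0%N) (tj_incr : forall j, (tj j < tj j.+1)%N)
  (m_le : (m <= nL.+1)%N)
  (phi_one : forall j y (i : 'I_nL.+1), (i < m)%N -> phi j y i 0 = 1)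
  (phi_bound : forall j y, X y -> enorm (phi j y) <= sigma)
  (theta_bound : 0 < theta < 1)
  (W_gt0 : forall i, 0 < W i)
  (uamax_lt : uamax < umax)
  (K_init : forall i, enorm (col i (K 0%N)) <= W i)
  (learning : forall j t, (tj j <= t < tj j.+1)%N ->
     ua t = - ((K t)^T *m phi j (x t)) /\
     K t.+1 = project_cols W
       (K t + (theta / enorm (phi j (x t)) ^+ 2) *:
          (phi j (x t) *m
             (mp_inverse (g (x t)) *m (x t.+1 - fbar f g (x t) (um t)))^T)))
  (* reference *)
  (N_gt0 : (0 < N)%N)
  (Q' : 'M[R]_d) (R' : 'M[R]_m) (Q'_pos : posdef Q') (R'_pos : posdef R')
  (Xr : set 'cV[R]_d) (Ur : set 'cV[R]_m)
  (Xr_sub : Xr `<=` X) (Ur_sub : Ur `<=` infball m (umax - uamax))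
  (xr : nat -> 'cV[R]_d) (ur : nat -> 'cV[R]_m)
  (reference : is_reference N f g Q' R' Xr Ur (x 0%N) xr ur)
  (* MPC component *)
  (Q Qf : 'M[R]_d) (Ru : 'M[R]_m)
  (Q_pos : posdef Q) (Qf_pos : posdef Qf) (Ru_pos : posdef Ru)
  (V : nat -> 'cV[R]_d -> \bar R := mpc_value N f g Q Qf Ru xr ur umax uamax ua)
  (ustar : nat -> nat -> 'cV[R]_m)
  (ustar_min : forall t,
     mpc_minimizer N f g Q Qf Ru xr ur umax uamax ua t (x t) (ustar t))
  (um_def : forall t, um t = ustar t 0%N)
  (* terminal assumption *)
  (alpha : R) (alpha_gt0 : 0 < alpha)
  (terminal : forall y, qform Qf y <= alpha ->
     exists2 v, infball m (umax - uamax) v &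
       qform Qf (fbar f g y v) - qform Qf y <= - (qform Q y + qform Ru v))
  (* constants *)
  (c c1 c2 c3 : R) (c_gt0 : 0 < c) (c1_gt0 : 0 < c1) (c1_lt_c2 : c1 < c2)
  (c3_gt0 : 0 < c3)
  (stage_ge : forall t, c1 * enorm (x t - xr t) ^+ 2 <=
     qform Q (x t - xr t) + qform Ru (ustar t 0%N - ur t))
  (stage_le : forall t,
     ((qform Q (x t - xr t) + qform Ru (ustar t 0%N - ur t))%:E <= V t (x t))%E)
  (V_le : forall t, (V t (x t) <= (c2 * enorm (x t - xr t) ^+ 2)%:E)%E)
  (cost_lip : forall t u, mpc_admissible N umax uamax (ua t) u ->
     forall y z,
       setsum (all_levels V c) (eball d (deltag * uamax + wmax)) y ->
       setsum (all_levels V c) (eball d (deltag * uamax + wmax)) z ->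
       `|mpc_cost N f g Q Qf Ru xr ur t y u - mpc_cost N f g Q Qf Ru xr ur t z u|
         <= c3 * enorm (y - z))
  (V_decay : forall t, level V c t (x t) ->
     (V t.+1 (x t.+1) <= (1 - c1 / c2)%:E * V t (x t) +
        (c3 * enorm (g (x t) *m (ua t + h (x t))))%:E)%E)
  (cbar : R := c2 * c3 / c1 * (deltag * uamax + wmax))
  (small : deltag * uamax + wmax < c1 / (c2 * c3) * c) :
  [/\ forall t, (N <= t)%N -> X (x t) -> (level V c t `\` level V cbar t) (x t) ->
        (V t.+1 (x t.+1) < V t (x t))%E,
      forall t, (N <= t)%N -> X (x t) -> level V cbar t (x t) ->
        level V cbar t.+1 (x t.+1) &
      all_levels V c `<=` X -> forall t, X (x t)].
Proof.
set w := deltag * uamax + wmax in cbar small *.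
have c2_gt0 : 0 < c2 by apply: lt_trans c1_lt_c2.
(* No induction: every weight after the initial one is the output of a projection, whatever was
   projected. *)
have K_bound t i : enorm (col i (K t)) <= W i.
  case: t => [|t]; first exact: K_init.
  have [j jP] := increasing_bracket t tj0 tj_incr.
  by rewrite (learning j t jP).2 enorm_col_project // ltW.
have ua_bound t : X (x t) -> enorm (ua t) <= uamax.
  move=> Xt; have [j jP] := increasing_bracket t tj0 tj_incr.
  rewrite (learning j t jP).1 enormN.
  apply: le_trans (enorm_trmx_mul _ _) _.
  apply: ler_pM; rewrite ?sqrtr_ge0 ?enorm_ge0 //; last exact: phi_bound.
  apply: ler_wsqrtr; apply: ler_sum => i _.
  by rewrite ler_sqr ?nnegrE ?enorm_ge0 // ltW.
have disturbance_bound t : X (x t) ->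
    enorm (g (x t) *m (ua t + h (x t))) <= w.
  move=> Xt; rewrite mulmxDr; apply: le_trans (ler_enormD _ _) _.
  apply: lerD => //; apply: le_trans (enorm_mulmx _ _) _.
  by apply: ler_pM; rewrite ?opnorm_ge0 ?enorm_ge0 //; exact: ua_bound.
(* The stage cost bounds the value below and [V_le] bounds it above, which excludes both infinities
   along the trajectory. *)
have V_fin t : exists r : R, V t (x t) = r%:E.
  have := V_le t; have := stage_le t.
  by case: (V t (x t)) => [r _ _|//|//]; exists r.
have rate : c1 / c2 * cbar = c3 * w.
  by rewrite /cbar; field; rewrite !gt_eqF.
have rate_gt0 : 0 < c1 / c2 by rewrite divr_gt0.
have rate_lt1 : c1 / c2 < 1 by rewrite ltr_pdivrMr // mul1r.
(* Multiplying [small] by [c3] compares [c1 / c2 * cbar] with [c1 / c2 * c]. *)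
have cbar_lt : cbar < c.
  rewrite -(ltr_pM2l rate_gt0) rate.
  have -> : c1 / c2 * c = c3 * (c1 / (c2 * c3) * c).
    by field; rewrite !gt_eqF.
  by rewrite ltr_pM2l.
(* By [rate], [(1 - c1 / c2) * r + c3 * w] is [r] lowered by [c1 / c2] times its excess over
   [cbar]. *)
have step t r : X (x t) -> V t (x t) = r%:E -> r <= c ->
    (V t.+1 (x t.+1) <= (r - c1 / c2 * (r - cbar))%:E)%E.
  move=> Xt Vt r_le; apply: le_trans (V_decay t _) _.
    by rewrite /level /= Vt lee_fin.
  rewrite Vt -EFinM -EFinD lee_fin mulrBl mul1r mulrBr rate opprB.
  rewrite -addrA lerD2l addrC lerD2r ler_pM2l //.
  exact: disturbance_bound.
have level_inv b t : cbar <= b -> b <= c -> X (x t) ->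
    level V b t (x t) -> level V b t.+1 (x t.+1).
  move=> b_ge b_le Xt; rewrite /level /=; have [r Vt] := V_fin t.
  rewrite Vt lee_fin => r_le.
  apply: le_trans (step t r Xt Vt (le_trans r_le b_le)) _.
  (* The bound is a convex combination of [r] and [cbar], both at most [b]. *)
  rewrite lee_fin; nra.
split=> [t _ Xt [Vc /= Vcbar]|t _ Xt|lev_sub].
- have [r Vt] := V_fin t; rewrite /level /= Vt in Vc Vcbar *.
  rewrite lee_fin in Vc; apply: le_lt_trans (step t r Xt Vt Vc) _.
  move/negP: Vcbar; rewrite lee_fin -ltNge => r_gt.
  by rewrite lte_fin ltrBlDr ltrDl mulr_gt0 ?subr_gt0.
- by apply: level_inv => //; exact: ltW.
(* Induction on level membership rather than on [X]: membership at time [t] yields [X (x t)], which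
   is what the disturbance bound for the next step requires. *)
suff lev t : level V c t (x t) by move=> t; apply: lev_sub; exists t.
elim: t => [|t IHt]; last first.
  by apply: level_inv => //; [exact: ltW|apply: lev_sub; exists t].
(* The reference starts at [x 0], so the quadratic upper bound on the value vanishes at time 0. *)
case: reference => -[xr0 _ _] _ _; apply: le_trans (V_le 0%N) _.
by rewrite xr0 subrr enorm0 expr0n mulr0 lee_fin ltW.
Qed.
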